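(* Let a Boolean control network $x(t+1)=Lu(t)x(t)$, $y(t)=Hx(t)$ be given, with weighted pair graph $\mathcal{G}$ (vertex set $\mathcal{V}$, edge set $\mathcal{E}$). The network is not Type-4 observable if and only if there is a cycle in $\mathcal{G}$ such that either the cycle contains a non-diagonal vertex, or there is a path in $\mathcal{G}$ from a non-diagonal vertex to (a vertex of) the cycle.
   Context: Fix positive integers $n,m,q$ and put $N=2^n$, $M=2^m$, $Q=2^q$. For a positive integer $k$, $\delta_k^i$ is the $i$-th column of the identity matrix $I_k$ and $\Delta_k=\{\delta_k^1,\dots,\delta_k^k\}$. A logical matrix of size $k\times s$ is one all of whose columns lie in $\Delta_k$. A Boolean control network (BCN, in algebraic form) is a system $x(t+1)=Lu(t)x(t)$, $y(t)=Hx(t)$, $t=0,1,2,\dots$, with states $x(t)\in\Delta_N$, inputs $u(t)\in\Delta_M$, outputs $y(t)\in\Delta_Q$, where $L$ is an $N\times NM$ logical matrix and $H$ is a $Q\times N$ logical matrix. Products are semi-tensor products; concretely $Lux=L(u\otimes x)$ for $u\in\Delta_M$, $x\in\Delta_N$, with $\otimes$ the Kronecker product. For $x_0\in\Delta_N$ and an infinite input sequence $U=u_0u_1\cdots\in(\Delta_M)^{\mathbb{N}}$, put $x_{t+1}=Lu_tx_t$ for $t\ge0$ and $(HL)_{x_0}^{\mathbb{N}}(U)=(Hx_1)(Hx_2)\cdots\in(\Delta_Q)^{\mathbb{N}}$. Type-4 observability: for any distinct $x_0,\bar x_0\in\Delta_N$ and any $U\in(\Delta_M)^{\mathbb{N}}$,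 $Hx_0=H\bar x_0$ implies $(HL)_{x_0}^{\mathbb{N}}(U)\neq(HL)_{\bar x_0}^{\mathbb{N}}(U)$. Weighted pair graph $\mathcal{G}$ (only its vertices and edges matter here): $\mathcal{V}$ is the set of unordered pairs $(x,x')$ (so $(x,x')=(x',x)$, and $x=x'$ is allowed) of elements of $\Delta_N$ with $Hx=Hx'$. There is a directed edge from $(x_1,x_1')$ to $(x_2,x_2')$ iff there is $u\in\Delta_M$ such that ($Lux_1=x_2$ and $Lux_1'=x_2'$) or ($Lux_1=x_2'$ and $Lux_1'=x_2$). A vertex $(x,x)$ is called diagonal; the other vertices are non-diagonal. Cycles and paths are directed, and a self-loop counts as a cycle. *)

(* Defs.v *)
From mathcomp Require Import all_boot all_order all_algebra.
From mathcomp Require Import mxtens.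

Set Implicit Arguments.
Unset Strict Implicit.
Unset Printing Implicit Defensive.

Import GRing.Theory.
Local Open Scope ring_scope.

(* 0/1 matrices are taken with integer entries, so that products are the usual
   matrix products. *)

Definition delta_seq (k : nat) : seq 'cV[int]_k :=
  [seq col i (1%:M : 'M[int]_k) | i : 'I_k].

(* Delta k is the finite subtype of 'cV[int]_k of the columns of the identity;
   its elements coerce to column vectors. *)
Definition Delta (k : nat) := seq_sub (delta_seq k).

Definition vec (k : nat) (x : Delta k) : 'cV[int]_k := val x.
Coercion vec : Delta >-> matrix.

Definition logical (k s : nat) (A : 'M[int]_(k, s)) : Prop :=
  forall j : 'I_s, col j A \in delta_seq k.

Section BCN.

(* N, M, Q are the numbers of states, inputs and outputs. *)
Variables (N M Q : nat) (L : 'M[int]_(N, M * N)) (H : 'M[int]_(Q, N)).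

(* Lux; the Kronecker product of two columns has 1 * 1 columns, which is
   convertible to 1. *)
Definition next (u : 'cV[int]_M) (x : 'cV[int]_N) : 'cV[int]_N :=
  L *m (u *t x : 'cV[int]_(M * N)).

Fixpoint state (x0 : 'cV[int]_N) (U : nat -> Delta M) (t : nat) : 'cV[int]_N :=
  if t is t'.+1 then next (U t') (state x0 U t') else x0.

(* The output sequence starts at time 1: Hx_0 is not part of it. *)
Definition HL (x0 : 'cV[int]_N) (U : nat -> Delta M) : nat -> 'cV[int]_Q :=
  fun t => H *m state x0 U t.+1.

Definition type4_observable : Prop :=
  forall (x0 x0' : Delta N) (U : nat -> Delta M),
    x0 <> x0' -> H *m x0 = H *m x0' -> ~ (HL x0 U =1 HL x0' U).

(* The unordered pair (x, x') is encoded as the set {x, x'}, which is a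
   singleton when x = x'. *)
Definition is_vertex (p : {set Delta N}) : bool :=
  [exists x : Delta N, exists x' : Delta N,
    (p == [set x; x']) && (H *m x == H *m x')].

Definition vertex := {p : {set Delta N} | is_vertex p}.

Definition pair_edge : rel vertex := fun p1 p2 =>
  [exists x1 : Delta N, exists x1' : Delta N,
   exists x2 : Delta N, exists x2' : Delta N,
    [&& val p1 == [set x1; x1'], val p2 == [set x2; x2'] &
     [exists u : Delta M,
        (next u x1 == x2) && (next u x1' == x2')
     || (next u x1 == x2') && (next u x1' == x2)]]].

Definition diagonal : pred vertex := fun p =>
  [exists x : Delta N, val p == [set x; x]].

End BCN.

Arguments pair_edge {N M Q} L H.

(* Main.v *)
Require Import Defs.
From mathcomp Require Import all_boot all_order all_algebra.
From mathcomp Require Import mxtens.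

Set Implicit Arguments.
Unset Strict Implicit.
Unset Printing Implicit Defensive.

Import GRing.Theory.

Local Open Scope ring_scope.

(** A pair of distinct states with equal outputs is driven by an input
    sequence through a sequence of pairs, and the two output sequences agree
    exactly when all these pairs are vertices of the pair graph.  So the network
    fails to be Type-4 observable iff an infinite walk of the pair graph starts
    at a non-diagonal vertex ([indistinguishable_walk],
    [walk_indistinguishable]).  As the graph is finite, such a walk exists iff
    its starting vertex reaches a cycle: a walk repeats a vertex by the
    pigeonhole principle ([walk_reaches_cycle]), and conversely one can walk to
    the cycle and go round it for ever ([reaches_cycle_walk]).

    The symmetry in the definition of an edge disappears once an edge from [p1]
    to [p2] is read as the equality of [p2] with the image of [p1] under the
    map induced by one input ([pair_edgeP]).  Hence an input sequence that
    labels a walk can be chosen before the endpoints of the pairs are told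
    apart: the two trajectories follow the walk as sets, whatever the order in
    which the edges list the states. *)

(** * Infinite walks in a finite directed graph *)

Section Walks.

Variables (T : finType) (e : rel T).

(** The cycle is given as an edge out of [w] closed by a path back to [w], not
    as a vertex sequence: this form is decidable, and a closed walk provides it
    at once.  [reaches_cycleP] recovers simple cycles. *)
Definition reaches_cycle (v : T) : bool :=
  [exists w, connect e v w && [exists w', e w w' && connect e w' w]].

Lemma reaches_cycleP (v : T) :
  reflect (exists c w, [/\ ucycle e c, w \in c & connect e v w])
          (reaches_cycle v).
Proof.
apply: (iffP existsP) => [[w /andP[vw /existsP[w' /andP[ww' w'w]]]]|].
  (* Removing the loops of the way back from w' to w leaves a simple cycle. *)
  case/connectP: w'w vw ww' => p0 /shortenP[p w'p Up _] -> vw ww'.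
  exists (w' :: p), (last w' p); split=> //; last exact: mem_last.
  by rewrite /ucycle Up andbT /= rcons_path w'p.
case=> c [w [/andP[Cc Uc] wc vw]]; exists w; rewrite vw /=.
apply/existsP; exists (path.next c w); rewrite (next_cycle Cc wc) /=.
(* Rotated so as to start at w, the rest of the cycle is the way back. *)
move: Cc; case/rot_to: (wc) => i p def_c.
rewrite -(rot_cycle i) -(next_rot i Uc) def_c.
case: p {def_c} => [|y p] /=; first by rewrite eqxx connect0.
rewrite eqxx; case/andP => _ yp.
apply/connectP; exists (rcons p w); first exact: yp.
by rewrite last_rcons.
Qed.

(** Reaching a cycle is preserved by a well-chosen move: the next vertex on the
    path to the cycle or, once on the cycle, the next vertex of the cycle. *)
Lemma reaches_cycle_step (v : T) :
  reaches_cycle v -> exists y, e v y && reaches_cycle y.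
Proof.
case/existsP => w /andP[/connectP[[|y p] /=]].
  move=> _ -> /existsP[w' /andP[vw' w'v]]; exists w'; rewrite vw' /=.
  apply/existsP; exists v; rewrite w'v /=.
  by apply/existsP; exists w'; rewrite vw' w'v.
case/andP => vy yp -> Cw; exists y; rewrite vy /=.
apply/existsP; exists (last y p); rewrite Cw andbT.
by apply/connectP; exists p.
Qed.

Lemma reaches_cycle_walk (v : T) :
  reaches_cycle v ->
  exists g : nat -> T, g 0%N = v /\ forall t, e (g t) (g t.+1).
Proof.
move=> Rv.
pose s x := odflt x [pick y | e x y && reaches_cycle y].
have sP x : reaches_cycle x -> e x (s x) && reaches_cycle (s x).
  by case/reaches_cycle_step => y; rewrite /s; case: pickP => //= /(_ y) ->.
have Rg t : reaches_cycle (iter t s v).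
  by elim: t => //= t /sP/andP[].
exists (fun t => iter t s v); split=> // t.
by case/andP: (sP _ (Rg t)).
Qed.

(** By the pigeonhole principle, two of the first [#|T|.+1] vertices of the walk
    coincide, and the walk between them is a closed one. *)
Lemma walk_reaches_cycle (g : nat -> T) :
  (forall t, e (g t) (g t.+1)) -> reaches_cycle (g 0%N).
Proof.
move=> eg.
have cg i k : connect e (g i) (g (i + k)%N).
  elim: k => [|k IHk]; first by rewrite addn0 connect0.
  by rewrite addnS; apply: connect_trans IHk (connect1 (eg _)).
suff [i [k gik]] : exists i k, g (i + k.+1)%N = g i.
  apply/existsP; exists (g i); rewrite -[i]add0n cg add0n /=.
  by apply/existsP; exists (g i.+1); rewrite eg /= -gik addnS -addSn cg.
pose f (i : 'I_#|T|.+1) := g i.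
have /injectivePn[x [y]] : ~~ injectiveb f.
  by apply/injectiveP => /leq_card; rewrite card_ord ltnn.
wlog lt_xy : x y / (x < y)%N => [IH|] nxy fxy.
  case: (ltngtP x y) => [xy|yx|/val_inj xy]; first exact: (IH x y).
    by apply: (IH y x); rewrite // eq_sym.
  by rewrite xy eqxx in nxy.
exists x, (y - x).-1; rewrite prednK ?subn_gt0 // subnKC; last exact: ltnW.
by rewrite [RHS]fxy.
Qed.

End Walks.

Arguments reaches_cycle {T} e v.

(** * The pair graph *)

Lemma delta_seqP (k : nat) (x : 'cV[int]_k) :
  reflect (exists i, x = col i 1%:M) (x \in delta_seq k).
Proof.
apply: (iffP mapP) => [[i _ ->]|[i ->]]; exists i => //.
by rewrite mem_enum.
Qed.

Section PairGraph.

Variables (N M Q : nat) (L : 'M[int]_(N, M * N)) (H : 'M[int]_(Q, N)).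
Hypothesis L_logical : logical L.

(** The Kronecker product of two columns of identity matrices is again one, so
    that [Lux] is a column of [L]. *)
Lemma next_logical (u : Delta M) (x : Delta N) :
  Defs.next L u x \in delta_seq N.
Proof.
case/delta_seqP: (valP u) => i ui; case/delta_seqP: (valP x) => j xj.
suff -> : Defs.next L u x = col (mxtens_index (i, j)) L by apply: L_logical.
rewrite /Defs.next colE; congr (_ *m _).
rewrite /vec [val u]ui [val x]xj.
apply/colP => k; case: (mxtens_indexP k) => a b; rewrite !mxE mxtens_indexK /=.
by rewrite (can_eq (@mxtens_indexK _ _)) xpair_eqE andbT -natrM mulnb.
Qed.

(** The transition map on the finite type of states; by [stepE] the default
    value [x] of [insubd] is never taken when [L] is logical. *)
Definition step (u : Delta M) (x : Delta N) : Delta N :=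
  insubd x (Defs.next L u x).

Lemma stepE (u : Delta M) (x : Delta N) : step u x = Defs.next L u x :> 'cV_N.
Proof. exact: insubdK (next_logical u x). Qed.

Lemma vertexP (p : vertex H) :
  exists x x', val p = [set x; x'] /\ H *m vec x = H *m vec x'.
Proof.
case/existsP: (valP p) => x /existsP[x' /andP[/eqP-> /eqP Hxx']].
by exists x, x'.
Qed.

(** Equality of outputs does not depend on the pair chosen to represent a
    vertex. *)
Lemma vertex_output (p : vertex H) (x x' : Delta N) :
  val p = [set x; x'] -> H *m vec x = H *m vec x'.
Proof.
case: (vertexP p) => y [y' [-> Hyy']] def_p.
have: x \in [set y; y'] by rewrite def_p set21.
have: x' \in [set y; y'] by rewrite def_p set22.
by case/set2P => -> /set2P[] ->.
Qed.

Lemma diagonal_set2 (p : vertex H) (x x' : Delta N) :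
  val p = [set x; x'] -> diagonal p = (x == x').
Proof.
move=> def_p; apply/existsP/eqP => [[y /eqP]|xx']; last first.
  by exists x; rewrite def_p -xx'.
rewrite def_p setUid => def_y.
have: x \in [set y] by rewrite -def_y set21.
have: x' \in [set y] by rewrite -def_y set22.
by move=> /set1P-> /set1P->.
Qed.

(** The two alternatives in the definition of an edge differ by a swap of the
    target states, which is invisible on unordered pairs. *)
Lemma pair_edgeP (p1 p2 : vertex H) :
  reflect (exists u, val p2 = step u @: val p1) (pair_edge L H p1 p2).
Proof.
apply: (iffP idP) => [|[u p2E]].
  case/existsP => x1 /existsP[x1' /existsP[x2 /existsP[x2']]].
  case/and3P => /eqP-> /eqP-> /existsP[u ux]; exists u.
  rewrite imsetU1 imset_set1.
  have stepP (x y : Delta N) : Defs.next L (vec u) x == vec y -> step u x = y.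
    by move/eqP=> uxy; apply: val_inj; rewrite [LHS]stepE.
  by case/orP: ux => /andP[/stepP-> /stepP->] //; rewrite setUC.
have [x [x' [p1E _]]] := vertexP p1.
apply/existsP; exists x; apply/existsP; exists x'.
apply/existsP; exists (step u x); apply/existsP; exists (step u x').
rewrite p2E p1E imsetU1 imset_set1 !eqxx /=.
by apply/existsP; exists u; rewrite !stepE !eqxx.
Qed.

Definition trajectory (x : Delta N) (U : nat -> Delta M) (t : nat) : Delta N :=
  iteri t (fun i => step (U i)) x.

Lemma trajectoryE (x : Delta N) U t :
  trajectory x U t = state L x U t :> 'cV_N.
Proof. by elim: t => //= t IHt; rewrite stepE IHt. Qed.

(** While the outputs agree, the pairs of states reached by the two trajectories
    are vertices, hence form an infinite walk. *)
Lemma indistinguishable_walk (x x' : Delta N) (U : nat -> Delta M) :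
  x <> x' -> H *m vec x = H *m vec x' -> HL L H x U =1 HL L H x' U ->
  exists2 v, ~~ diagonal v & reaches_cycle (pair_edge L H) v.
Proof.
move=> nxx' Hxx' HLxx'.
pose P t := [set trajectory x U t; trajectory x' U t].
have Pv t : is_vertex H (P t).
  apply/existsP; exists (trajectory x U t).
  apply/existsP; exists (trajectory x' U t).
  rewrite eqxx !trajectoryE; apply/eqP.
  by case: t => // t; apply: HLxx'.
pose g t : vertex H := exist _ (P t) (Pv t).
exists (g 0%N); first by rewrite (@diagonal_set2 _ x x') //; apply/eqP.
apply: walk_reaches_cycle => t; apply/pair_edgeP; exists (U t).
by rewrite /= /P imsetU1 imset_set1.
Qed.

(** Inputs labelling the edges of an infinite walk drive the two states of its
    first vertex along the walk, so that the outputs agree at all times. *)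
Lemma walk_indistinguishable (v : vertex H) :
  ~~ diagonal v -> reaches_cycle (pair_edge L H) v -> ~ type4_observable L H.
Proof.
move=> ndv /reaches_cycle_walk[g [g0 eg]] obs.
have [x [x' [def_v Hxx']]] := vertexP v.
have [U gS] : exists U : nat -> Delta M,
    forall t, val (g t.+1) = step (U t) @: val (g t).
  have exU t : exists u, val (g t.+1) == step u @: val (g t).
    by have /pair_edgeP[u gE] := eg t; exists u; apply/eqP.
  by exists (fun t => xchoose (exU t)) => t; apply/eqP/(xchooseP (exU t)).
have gE t : val (g t) = [set trajectory x U t; trajectory x' U t].
  elim: t => [|t IHt]; first by rewrite g0.
  by rewrite gS IHt imsetU1 imset_set1.
apply: (obs x x' U) => [||t] //.
  by apply/eqP; rewrite -(diagonal_set2 def_v).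
by rewrite /HL -!trajectoryE; apply: vertex_output (gE t.+1).
Qed.

End PairGraph.

Theorem mainTheorem8 (n m q : nat)
    (n_gt0 : (0 < n)%N) (m_gt0 : (0 < m)%N) (q_gt0 : (0 < q)%N)
    (L : 'M[int]_((2 ^ n)%N, (2 ^ m * 2 ^ n)%N))
    (H : 'M[int]_((2 ^ q)%N, (2 ^ n)%N))
    (L_logical : logical L) (H_logical : logical H) :
  ~ type4_observable L H <->
  exists c : seq (vertex H),
    [/\ c <> [::], ucycle (pair_edge L H) c &
        (exists2 v, v \in c & ~~ diagonal v) \/
        (exists v w, [/\ ~~ diagonal v, w \in c & connect (pair_edge L H) v w])].
Proof.
(* Non-observability yields no witnesses directly; but reaching a cycle is
   decidable, so it can be assumed to fail in order to derive observability. *)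
split=> [nobs | [c [_ Uc cyc]]].
  have [/existsP[v /andP[ndv /reaches_cycleP[c [w [Uc wc vw]]]]]|noR] :=
    boolP [exists v : vertex H,
             ~~ diagonal v && reaches_cycle (pair_edge L H) v].
    exists c; split=> //; first by case: c wc {Uc}.
    by right; exists v, w.
  case: nobs => x x' U nxx' Hxx' HLxx'.
  have [v ndv Rv] := indistinguishable_walk L_logical nxx' Hxx' HLxx'.
  by case/existsP: noR; exists v; rewrite ndv.
have [v [w [ndv wc vw]]] :
    exists v w, [/\ ~~ diagonal v, w \in c & connect (pair_edge L H) v w].
  by case: cyc => // -[v vc ndv]; exists v, v.
apply: (walk_indistinguishable L_logical ndv).
by apply/reaches_cycleP; exists c, w.
Qed.
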